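(* Let $k\geq 1$ and let $\alpha_1,\ldots,\alpha_k$ be positive integers. The grid graph $G(\alpha_1,\ldots,\alpha_k)$ is planar if and only if one of the following holds: (1) $k\leq 2$; or (2) $k=3$ and at most one of $\alpha_1,\alpha_2,\alpha_3$ is greater than $1$.
   Context: For a positive integer $\alpha$, $P_\alpha$ is the path graph with vertex set $\{0,1,\ldots,\alpha\}$ where two vertices are adjacent iff they differ by exactly $1$. The $k$-dimensional grid graph $G(\alpha_1,\ldots,\alpha_k)$ (all $\alpha_i$ positive integers) is the Cartesian product of graphs $P_{\alpha_1}\,\square\,\cdots\,\square\, P_{\alpha_k}$. A graph is planar if it embeds on the plane (equivalently, on the $2$-sphere). *)

(* Defs.v *)
From HB Require Import structures.
From mathcomp Require Import all_boot all_order all_algebra.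
From mathcomp Require Import all_classical all_reals all_analysis.
Import numFieldNormedType.Exports.

Set Implicit Arguments.
Unset Strict Implicit.
Unset Printing Implicit Defensive.

Import Order.TTheory GRing.Theory Num.Theory.

Record sgraph := SGraph {
  vertex :> finType;
  adj : rel vertex;
  adj_sym : symmetric adj;
  adj_irr : irreflexive adj }.

Section PathGraph.
Variable a : nat.

Definition path_adj (x y : 'I_a.+1) : bool :=
  (y == x.+1 :> nat) || (x == y.+1 :> nat).

Lemma path_adj_sym : symmetric path_adj.
Proof. by move=> x y; rewrite /path_adj orbC. Qed.

Lemma path_adj_irr : irreflexive path_adj.
Proof. by move=> x; rewrite /path_adj orbb; apply/negbTE; rewrite neq_ltn ltnSn. Qed.

(* a is the number of edges: the vertex set is {0, ..., a}. *)
Definition path_graph : sgraph := SGraph path_adj_sym path_adj_irr.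

End PathGraph.

Section CartesianProduct.
Variables (I : finType) (G : I -> sgraph).

Definition box_adj (x y : {dffun forall i, G i}) : bool :=
  [exists i, adj (x i) (y i) && [forall j, (j != i) ==> (x j == y j)]].

Lemma box_adj_sym : symmetric box_adj.
Proof.
suff imp x y : box_adj x y -> box_adj y x by move=> x y; apply/idP/idP; apply: imp.
move=> /existsP[i /andP[xy /forallP E]]; apply/existsP; exists i.
by rewrite adj_sym xy; apply/forallP => j; rewrite [y j == _]eq_sym; exact: E.
Qed.

Lemma box_adj_irr : irreflexive box_adj.
Proof. by move=> x; apply/existsP => -[i]; rewrite adj_irr. Qed.

Definition box_graph : sgraph := SGraph box_adj_sym box_adj_irr.

End CartesianProduct.

Definition grid_graph (k : nat) (alpha : 'I_k -> nat) : sgraph :=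
  box_graph (fun i : 'I_k => path_graph (alpha i)).

Local Open Scope classical_set_scope.
Local Open Scope ring_scope.

Section Planarity.
Variable R : realType.

Definition is_arc (p q : R * R) (A : set (R * R)) : Prop :=
  exists g : R -> R * R,
    [/\ {within `[0, 1], continuous g},
        {in `[0, 1] &, injective g},
        g 0 = p, g 1 = q & A = g @` `[0, 1]].

(* A drawing of G in the plane: pos places the vertices, and E x y is the arc
   that represents the edge {x, y}; the values of E on non-adjacent pairs are
   irrelevant.  The interior of an arc (the arc minus its two ends) meets
   neither a vertex nor another edge; edges are unordered pairs. *)
Definition plane_embedding (G : sgraph) (pos : G -> R * R)
    (E : G -> G -> set (R * R)) : Prop :=
  let interior_of x y := E x y `\` [set pos x; pos y] in
  [/\ injective pos,
      forall x y, adj x y -> E x y = E y x,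
      forall x y, adj x y -> is_arc (pos x) (pos y) (E x y),
      forall x y, adj x y -> interior_of x y `&` range pos = set0 &
      forall x y u v, adj x y -> adj u v ->
        [set x; y]%SET != [set u; v]%SET ->
        interior_of x y `&` E u v = set0].

Definition planar (G : sgraph) : Prop :=
  exists (pos : G -> R * R) (E : G -> G -> set (R * R)), plane_embedding pos E.

End Planarity.

(* Main.v *)
Require Import Defs.
From HB Require Import structures.
From mathcomp Require Import all_boot all_order all_algebra.
From mathcomp Require Import all_classical all_reals all_analysis.
From mathcomp Require Import lra ring.
From Stdlib Require Import Btauto.
Import numFieldNormedType.Exports.
Import Order.TTheory GRing.Theory Num.Theory.

Set Implicit Arguments.
Unset Strict Implicit.
Unset Printing Implicit Defensive.

Local Open Scope ring_scope.
Local Open Scope classical_set_scope.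

(** Planar grids are drawn with straight segments: lattice points of the plane in
dimension at most two, and concentric squares joined by their diagonals when
two sides of a three-dimensional grid are equal to 1. An interior point of an
edge determines the edge: in the lattice through its only non-integral
coordinate, in the squares through its sup norm and the coordinates that attain
it ([grid_dim2_planar], [concentric_squares_planar]).

In the other direction, a grid of dimension at least four contains the
4-dimensional cube, and a three-dimensional grid with two sides greater than 1
contains the grid with 3 x 3 x 2 vertices. Both contain a subdivision of the
complete bipartite graph K(3,3), and the point is that K(3,3) has no topological
drawing ([K33_subdivision_not_planar]). The proof does not use the Jordan curve
theorem; it is a mod 2 form of the van Kampen obstruction.

If [e] and [f] are disjoint arcs, then [e s - f t] is a nowhere zero map on a
square, so its angle has zero variation around the boundary. That boundary
consists of [e] seen from the two ends of [f] and of [f] seen from the two ends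
of [e]. Only the parity of the crossings of the upward ray is needed, and by
compactness ([embedding_gap]) and connectedness ([connected_chain]) the arcs may
be replaced by polylines with steps shorter than half the distance between
disjoint edges. The angle argument then becomes a finite telescoping sum
([ray_parity_rectangle]), with neither general position nor genuine curves.

Write K(3,3) as three tripods with common feet. Adding the identities for the
legs of two tripods that end at different feet shows that the tripods carry
opposite bits ([tripod_parity_neq]), like the two cyclic orders in which the feet
can be met. Three tripods cannot be pairwise opposite. *)

Lemma addb_xorb b c : b (+) c = xorb b c. Proof. by case: b; case: c. Qed.

(** * Crossing parities of polylines *)

Section Winding.
Variable R : realType.
Implicit Types (a b p q w x y z : R * R) (s t : seq (R * R)).

(** The vertical axis is split by its second coordinate, so that a nonzero vector
and its opposite never point to the same side; parities of crossings then need
no general position. *)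
Definition leftward a : bool := (a.1 < 0) || (a.1 == 0) && (a.2 < 0).

Definition upward a : bool := 0 < a.2.

(** Whether the short segment from [a] to [b] crosses the upward vertical ray
from the origin: for vectors far from 0 compared with their distance, a change
of side can only happen well above or well below the origin, and [upward b] says
which. *)
Definition ray_crossing a b : bool := (leftward a (+) leftward b) && upward b.

(** Parity of the number of times the polyline [x :: s] crosses the upward ray
from [w]; a discrete mod 2 substitute for the variation of the angle seen from
[w]. *)
Fixpoint ray_parity w x s : bool :=
  if s is y :: s' then ray_crossing (x - w) (y - w) (+) ray_parity w y s' else false.

Definition chain (d : R) := path (fun x y => `|x - y| < d).

Definition apart (d : R) s t := forall x y, x \in s -> y \in t -> d <= `|x - y|.

Lemma leftward_opp a : a != 0 -> leftward (- a) = ~~ leftward a.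
Proof.
case: a => a1 a2; rewrite /leftward /= => a0.
have {}a0 : ~ (a1 = 0 /\ a2 = 0) by move=> [e1 e2]; rewrite e1 e2 eqxx in a0.
rewrite oppr_lt0 oppr_eq0 oppr_lt0.
case: (ltrgtP a1 0) => //= h1.
by case: (ltrgtP a2 0) => //= h2; case: a0.
Qed.

Lemma norm_pair_lt a d : (`|a| < d) = (`|a.1| < d) && (`|a.2| < d).
Proof. by rewrite prod_normE gt_max. Qed.

Lemma norm_pair_ge a d : (d <= `|a|) = (d <= `|a.1|) || (d <= `|a.2|).
Proof. by rewrite prod_normE le_max. Qed.

Lemma leftward_neq_ltr a b d : `|a - b| < d -> leftward a != leftward b -> `|a.1| < d.
Proof.
rewrite norm_pair_lt => /andP[/= h _]; rewrite /leftward => ne.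
have {ne} : (a.1 <= 0 <= b.1) || (b.1 <= 0 <= a.1).
  by move: ne; case: (ltrgtP a.1 0); case: (ltrgtP b.1 0).
move: h; rewrite !ltr_norml => /andP[h1 h2] /orP[] /andP[h3 h4].
  by apply/andP; split; lra.
by apply/andP; split; lra.
Qed.

(** Two nearby vectors on different sides are both close to the vertical axis;
being far from the origin, they lie on the same half of it. *)
Lemma leftward_neq_upward a b d : d <= `|a| -> d <= `|b| -> `|a - b| < d ->
  leftward a != leftward b -> upward a = upward b.
Proof.
move=> a0 b0 ab ne; have h1 := leftward_neq_ltr ab ne.
rewrite distrC in ab; rewrite eq_sym in ne; have h2 := leftward_neq_ltr ab ne.
move: a0 b0 ab; rewrite !norm_pair_ge norm_pair_lt.
rewrite (leNgt _ `|a.1|) (leNgt _ `|b.1|) h1 h2 /=.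
move=> a2 b2 /andP[_]; rewrite ltr_norml /upward => /andP[d1 d2].
apply/idP/idP => h0.
  by rewrite ltNge; apply/negP => bn; move: a2 b2; rewrite (ger0_norm (ltW h0)) (ler0_norm bn); lra.
by rewrite ltNge; apply/negP => bn; move: a2 b2; rewrite (ger0_norm (ltW h0)) (ler0_norm bn); lra.
Qed.

(** Local closedness: among four vectors close to each other and far from 0,
either no side changes or all vertical directions that matter agree, so the two
ways from [a] to [e] cross the ray equally often mod 2. *)
Lemma ray_crossing_quad a b c e d :
    d <= `|a| -> d <= `|b| -> d <= `|c| -> d <= `|e| ->
    `|a - b| < d -> `|a - c| < d -> `|a - e| < d ->
    `|b - c| < d -> `|b - e| < d -> `|c - e| < d ->
  ray_crossing a b (+) ray_crossing b e = ray_crossing a c (+) ray_crossing c e.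
Proof.
move=> a0 b0 c0 e0 ab ac ae bc be ce.
have := leftward_neq_upward a0 b0 ab; have := leftward_neq_upward a0 c0 ac.
have := leftward_neq_upward a0 e0 ae; have := leftward_neq_upward b0 c0 bc.
have := leftward_neq_upward b0 e0 be; have := leftward_neq_upward c0 e0 ce.
rewrite /ray_crossing.
by case: (leftward a); case: (leftward b); case: (leftward c); case: (leftward e) => //=;
  do ![move=> /(_ isT) -> | move=> _]; rewrite ?addbF ?addFb ?addbb.
Qed.

(** A change of side crosses exactly one of the upward and the downward ray. *)
Lemma ray_crossing_opp a b d : 0 < d -> d <= `|a| -> d <= `|b| -> `|a - b| < d ->
  ray_crossing (- a) (- b) = ray_crossing a b (+) (leftward a (+) leftward b).
Proof.
move=> d0 a0 b0 ab.
have nz x : d <= `|x| -> x != 0.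
  by move=> dx; rewrite -normr_gt0; apply: lt_le_trans dx.
rewrite /ray_crossing !leftward_opp ?nz // addbN addNb negbK.
case: (boolP (leftward a == leftward b)) => [/eqP->|ne]; first by rewrite addbb.
have -> : leftward a (+) leftward b = true by move: ne; case: (leftward a); case: (leftward b).
rewrite /= /upward /= oppr_gt0 addbT.
rewrite eq_sym in ne; rewrite distrC in ab; have b1 := leftward_neq_ltr ab ne.
move: b0; rewrite norm_pair_ge leNgt b1 /= => b2.
have : b.2 != 0 by rewrite -normr_gt0; apply: lt_le_trans b2.
by case: (ltrgtP b.2 0).
Qed.

Section Rectangle.
Variables (d : R).
Hypothesis d_gt0 : 0 < d.

Lemma dist_sub2 x y w z : `|x - y| < d -> `|w - z| < d ->
  `|(x - w) - (y - z)| < d *+ 2.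
Proof.
move=> xy wz; have -> : (x - w) - (y - z) = (x - y) - (w - z).
  by rewrite !opprB addrACA [RHS]addrACA [- w - y]addrC.
by rewrite mulr2n (le_lt_trans (ler_normB _ _)) // ltrD.
Qed.

Lemma dist_self x : `|x - x| < d. Proof. by rewrite subrr normr0. Qed.

(** Moving the viewpoint from [w] to a neighbour [z] changes the parity only
through the two ends of the polyline: the quadrilaterals of consecutive vectors
telescope. *)
Lemma ray_parity_strip w z x s : `|w - z| < d -> chain d x s ->
    apart (d *+ 2) (x :: s) [:: w; z] ->
  ray_parity w x s (+) ray_parity z x s =
  ray_crossing (x - w) (x - z) (+) ray_crossing (last x s - w) (last x s - z).
Proof.
move=> wz; elim: s x => [|y s IH] x /=; first by rewrite addbb.
move=> /andP[xy ys] sep.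
have sub : apart (d *+ 2) (y :: s) [:: w; z].
  by move=> p q hp hq; apply: sep => //; rewrite inE hp orbT.
have ww := dist_self w; have zz := dist_self z.
have xx := dist_self x; have yy := dist_self y.
have zw : `|z - w| < d by rewrite distrC.
  have yx : `|y - x| < d by rewrite distrC.
have [x1 x2 y1 y2] : [/\ x \in x :: y :: s, w \in [:: w; z],
   y \in x :: y :: s & z \in [:: w; z]] by rewrite !inE !eqxx !orbT.
have Q : ray_crossing (x - w) (y - w) (+) ray_crossing (y - w) (y - z) =
         ray_crossing (x - w) (x - z) (+) ray_crossing (x - z) (y - z).
  by apply: (@ray_crossing_quad _ _ _ _ (d *+ 2)); first [exact: sep | exact: dist_sub2].
have /(canRL (addbK _)) Wy := IH y ys sub.
have /(canRL (addbK _)) -> := Q.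
rewrite Wy !addb_xorb; btauto.
Qed.

(** The crossings of the vectors from a moving viewpoint to [x] are read as
crossings of the moving point seen from [x], at the cost of the end terms. *)
Lemma ray_crossing_swap x w z : d *+ 2 <= `|x - w| -> d *+ 2 <= `|x - z| ->
    `|w - z| < d ->
  ray_crossing (x - w) (x - z) = ray_crossing (w - x) (z - x) (+) (leftward (w - x) (+) leftward (z - x)).
Proof.
move=> xw xz wz; rewrite -(opprB w) -(opprB z) (@ray_crossing_opp _ _ (d *+ 2)) //.
- by rewrite pmulrn_lgt0.
- by rewrite distrC.
- by rewrite distrC.
- exact: dist_sub2 wz (dist_self x).
Qed.

(** For two polylines that stay apart, the vectors joining them form a discrete
rectangle that avoids the origin, so the parity along its boundary is zero. The
four sides are the two polylines, each seen from the ends of the other one; the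
[leftward] terms come from reversing the vectors on two of the sides. *)
Lemma ray_parity_rectangle x s w t : chain d x s -> chain d w t ->
    apart (d *+ 2) (x :: s) (w :: t) ->
  ray_parity w x s (+) ray_parity (last w t) x s =
  (ray_parity x w t (+) (leftward (w - x) (+) leftward (last w t - x))) (+)
  (ray_parity (last x s) w t (+) (leftward (w - last x s) (+) leftward (last w t - last x s))).
Proof.
move=> xs; elim: t w => [|z t IH] w /=; first by rewrite !addbb.
move=> /andP[wz zt] sep.
have sub : apart (d *+ 2) (x :: s) (z :: t).
  by move=> p q hp hq; apply: sep => //; rewrite inE hq orbT.
have sub2 : apart (d *+ 2) (x :: s) [:: w; z].
  move=> p q hp; rewrite !inE => hq; apply: sep => //.
  by rewrite !inE; case/orP: hq => ->; rewrite ?orbT.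
have [w1 z1] : w \in [:: w; z] /\ z \in [:: w; z] by rewrite !inE !eqxx orbT.
have /(canRL (addKb _)) -> := IH z zt sub.
have /(canRL (addbK _)) -> := ray_parity_strip wz xs sub2.
rewrite !ray_crossing_swap ?sub2 ?mem_head ?mem_last // !addb_xorb.
btauto.
Qed.

End Rectangle.
End Winding.

(** * Polygonal drawings of the complete bipartite graph on 3 + 3 vertices *)

Section K33Chains.
Variables (R : realType) (d : R) (a b : 'I_3 -> R * R)
  (W : 'I_3 -> 'I_3 -> seq (R * R)).
Hypothesis d_gt0 : 0 < d.
Hypothesis chainW : forall i j, chain d (a i) (W i j).
Hypothesis lastW : forall i j, last (a i) (W i j) = b j.
Hypothesis apartW : forall i i' j j', i != i' -> j != j' ->
  apart (d *+ 2) (a i :: W i j) (a i' :: W i' j').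

(** The three polylines issued from [a i] form a tripod with feet [b 0], [b 1] and
[b 2]. This bit plays the part of the cyclic order of its legs. *)
Definition tripod_parity i : bool :=
  let n (j j' : nat) := ray_parity (b (inord j')) (a i) (W i (inord j)) in
  ((n 0 1 (+) n 0 2) (+) (n 1 0 (+) n 1 2) (+) (n 2 0 (+) n 2 1))%N.

Lemma leftward_ends (i i' j j' : 'I_3) : i != i' -> j != j' ->
  leftward (b j - b j') = ~~ leftward (b j' - b j).
Proof.
move=> ii jj; rewrite -opprB leftward_opp // -normr_gt0 distrC.
apply: (@lt_le_trans _ _ (d *+ 2)); first by rewrite pmulrn_lgt0.
have b_end k l : b l \in a k :: W k l by rewrite -(lastW k l) mem_last.
exact: apartW ii jj _ _ (b_end i j) (b_end i' j').
Qed.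

(** Sum the rectangle identities of leg [j] of one tripod and leg [j'] of the other
over the six ordered pairs [j != j']. A leg seen from the apex of the other
tripod is counted for two values of [j'], hence cancels, and so do the
comparisons involving an apex. What remains of the comparisons is one
[leftward] bit for each ordered pair of feet, that is, a sum of three ones. *)
Lemma tripod_parity_neq (i i' : 'I_3) : i != i' -> tripod_parity i' = ~~ tripod_parity i.
Proof.
move=> ii; rewrite /tripod_parity.
have ne (j j' : nat) : (j < 3)%N -> (j' < 3)%N -> j != j' ->
    (inord j : 'I_3) != inord j'.
  by move=> h h' jj; rewrite -val_eqE /= !inordK.
have rect (j j' : 'I_3) : j != j' ->
    ray_parity (b j') (a i) (W i j) = ray_parity (a i') (a i) (W i j) (+)
    ((ray_parity (a i) (a i') (W i' j') (+) (leftward (a i' - a i) (+) leftward (b j' - a i))) (+)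
     (ray_parity (b j) (a i') (W i' j') (+) (leftward (a i' - b j) (+) leftward (b j' - b j)))).
  move=> jj; apply: (canRL (addKb _)).
  by have := ray_parity_rectangle d_gt0 (chainW i j) (chainW i' j') (apartW ii jj);
    rewrite !lastW.
have l1 : leftward (b (inord 1) - b (inord 0)) = _ := leftward_ends ii (ne 1 0 isT isT isT)%N.
have l2 : leftward (b (inord 2) - b (inord 0)) = _ := leftward_ends ii (ne 2 0 isT isT isT)%N.
have l3 : leftward (b (inord 2) - b (inord 1)) = _ := leftward_ends ii (ne 2 1 isT isT isT)%N.
rewrite [in RHS](rect _ _ (ne 0 1 isT isT isT)%N).
rewrite [in RHS](rect _ _ (ne 0 2 isT isT isT)%N).
rewrite [in RHS](rect _ _ (ne 1 0 isT isT isT)%N).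
rewrite [in RHS](rect _ _ (ne 1 2 isT isT isT)%N).
rewrite [in RHS](rect _ _ (ne 2 0 isT isT isT)%N).
rewrite [in RHS](rect _ _ (ne 2 1 isT isT isT)%N).
rewrite l1 l2 l3 !addb_xorb -!/(negb _); btauto.
Qed.

(** Three tripods, two possible parities. *)
Lemma no_K33_chains : False.
Proof.
have := @tripod_parity_neq (inord 0) (inord 1).
have := @tripod_parity_neq (inord 0) (inord 2).
have := @tripod_parity_neq (inord 1) (inord 2).
rewrite -!val_eqE /= !inordK // => /(_ isT)-> /(_ isT)E /(_ isT)E'.
by move: E; rewrite E' negbK; case: tripod_parity.
Qed.
End K33Chains.

(** * From arcs to polylines *)

Section PlaneSets.
Variable R : realType.
Implicit Types (p q : R * R) (A B : set (R * R)).

(** Points reachable from [p] inside [A] by steps shorter than [d] form a subset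
that is both relatively open and relatively closed. *)
Lemma connected_chain A p q (d : R) : connected A -> A p -> A q -> 0 < d ->
  exists s, [/\ chain d p s, last p s = q & {in s, forall z, A z}].
Proof.
move=> cA Ap Aq d0.
pose reach z := exists s, [/\ chain d p s, last p s = z & {in s, forall z, A z}].
pose B := [set z | A z /\ reach z].
have step y z : A y -> B y -> A z -> `|y - z| < d -> B z.
  move=> Ay [_ [s [ps ls As]]] Az yz; split=> //; exists (rcons s z); split.
  - by rewrite /chain rcons_path ls yz andbT.
  - by rewrite last_rcons.
  - by move=> x; rewrite mem_rcons inE => /orP[/eqP->|/As].
suff BA : B = A by have [] : B q by rewrite BA.
apply: cA.
- by exists p; split=> //; exists [::]; split.
- exists (\bigcup_(y in B) ball y d); first by apply: bigcup_open => y _; exact: ball_open.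
  apply/seteqP; split=> [z Bz|z [Az [y By yz]]].
    by split; [case: Bz | exists z => //; exact: ballxx].
  by move: yz; rewrite -ball_normE; apply: step => //; case: By.
- exists (~` \bigcup_(y in A `\` B) ball y d).
    by apply: open_closedC; apply: bigcup_open => y _; exact: ball_open.
  apply/seteqP; split=> [z Bz|z [Az nz]].
    split; first by case: Bz.
    move=> [y [Ay nBy] yz]; apply: nBy.
    move: yz; rewrite -ball_normE /= distrC; apply: step => //; by case: Bz.
  by apply: contrapT => nBz; apply: nz; exists z => //; exact: ballxx.
Qed.

Lemma compact_disjoint_apart A B : compact A -> compact B -> A `&` B = set0 ->
  exists2 e : R, 0 < e & forall x y, A x -> B y -> e <= `|x - y|.
Proof.
move=> cA cB AB.
have [[x0 Ax0]|A0] := pselect (A !=set0); last first.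
  by exists 1 => // x y Ax; case: A0; exists x.
have [[y0 By0]|B0] := pselect (B !=set0); last first.
  by exists 1 => // x y _ By; case: B0; exists y.
have cAB := compact_setX cA cB.
have AB0 : A `*` B !=set0 by exists (x0, y0).
have cont : {within A `*` B, continuous (fun z : (R * R) * (R * R) => `|z.1 - z.2|)}.
  apply: continuous_subspaceT => z.
  apply: cvg_norm; apply: cvgB; [exact: cvg_fst | exact: cvg_snd].
have [[x y] ] := compact_EVT_min AB0 cAB cont.
rewrite inE /= => -[/= Ax By] mn.
exists `|x - y|.
  rewrite normr_gt0 subr_eq0; apply/eqP => xy.
  have : (A `&` B) x by split=> //; rewrite xy.
  by rewrite AB.
by move=> u v Au Bv; apply: (mn (u, v)); rewrite inE.
Qed.

Lemma arc_compact p q A : is_arc p q A -> compact A.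
Proof.
move=> [g [cg _ _ _ ->]]; apply: continuous_compact => //; exact: segment_compact.
Qed.

Lemma arc_connected p q A : is_arc p q A -> connected A.
Proof.
move=> [g [cg _ _ _ ->]]; apply: connected_continuous_connected => //.
exact: segment_connected.
Qed.

Lemma arc_ends p q A : is_arc p q A -> A p /\ A q.
Proof.
by move=> [g [_ _ <- <- ->]]; split; [exists 0 | exists 1] => //=;
  rewrite in_itv /= lexx ler01.
Qed.
End PlaneSets.

Section Drawing.
Variables (R : realType) (G : sgraph) (pos : G -> R * R)
  (E : G -> G -> set (R * R)).
Hypothesis emb : plane_embedding pos E.

Lemma disjoint_edges_disjoint_arcs x y u v : adj x y -> adj u v ->
  [disjoint [:: x; y] & [:: u; v]]%B -> E x y `&` E u v = set0.
Proof.
case: emb => inj _ arcE avoid cross xy uv dis; apply/seteqP; split=> // z [zxy zuv].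
have nxy w : w \in [:: x; y] -> z <> pos w.
  move=> wxy ez; have wuv : w \notin [:: u; v] by rewrite (disjointFr dis wxy).
  have : ((E u v `\` [set pos u; pos v]) `&` range pos) z.
    split; last by exists w.
    split=> // -[] /=; rewrite ez => /inj ew; move: wuv; rewrite ew !inE eqxx ?orbT //.
  by rewrite avoid.
have ne : [set x; y]%SET != [set u; v]%SET.
  apply/eqP => /setP/(_ x); rewrite !inE eqxx /= => /esym xuv.
  by have := disjointFr dis (mem_head x [:: y]); rewrite !inE xuv.
have : ((E x y `\` [set pos x; pos y]) `&` E u v) z.
  by do 2!split=> //; case; apply: nxy; rewrite !inE eqxx ?orbT.
by rewrite cross.
Qed.

(** There are finitely many pairs of edges, so the distances between the compact
arcs of vertex-disjoint edges have a common positive lower bound. *)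
Lemma embedding_gap : exists2 e : R, 0 < e & forall x y u v, adj x y -> adj u v ->
  [disjoint [:: x; y] & [:: u; v]]%B ->
  forall p q, E x y p -> E u v q -> e <= `|p - q|.
Proof.
case: (emb) => _ _ arcE _ _.
pose ok (c : (G * G) * (G * G)) (e : R) := adj c.1.1 c.1.2 -> adj c.2.1 c.2.2 ->
  [disjoint [:: c.1.1; c.1.2] & [:: c.2.1; c.2.2]]%B ->
  forall p q, E c.1.1 c.1.2 p -> E c.2.1 c.2.2 q -> e <= `|p - q|.
have /choice[e eP] c : exists e : R, 0 < e /\ ok c e.
  case: c => [[x y] [u v]].
  have [xy|nxy] := boolP (adj x y); last by exists 1; split=> // /= xy; rewrite xy in nxy.
  have [uv|nuv] := boolP (adj u v); last by exists 1; split=> // /= _ uv; rewrite uv in nuv.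
  have [dis|nd] := boolP [disjoint [:: x; y] & [:: u; v]]%B; last first.
    by exists 1; split=> // /= _ _ dis; rewrite dis in nd.
  have [e e0 he] := compact_disjoint_apart (arc_compact (arcE _ _ xy))
     (arc_compact (arcE _ _ uv)) (disjoint_edges_disjoint_arcs xy uv dis).
  by exists e; split=> // _ _ _ p q; exact: he.
exists (\big[Order.min/1]_c e c).
  by apply: lt_bigmin => // c _; case: (eP c).
move=> x y u v xy uv dis p q hp hq.
have [_ h] := eP ((x, y), (u, v)).
by apply: le_trans (h xy uv dis p q hp hq); exact: bigmin_le_cond.
Qed.

End Drawing.

Section K33Graph.
Variables (R : realType) (G : sgraph).

(** Concatenation of the polylines [c] along a path of the graph. *)
Fixpoint walk (c : G -> G -> seq (R * R)) (x : G) (s : seq G) : seq (R * R) :=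
  if s is y :: s' then c x y ++ walk c y s' else [::].

Section Walk.
Variables (pos : G -> R * R) (E : G -> G -> set (R * R)) (d : R).
Variable (c : G -> G -> seq (R * R)).
Hypothesis cP : forall x y, adj x y ->
  [/\ chain d (pos x) (c x y), last (pos x) (c x y) = pos y &
      {in c x y, forall z, E x y z}].
Hypothesis E_start : forall x y, adj x y -> E x y (pos x).

Lemma walk_chain x s : path (@adj G) x s ->
  chain d (pos x) (walk c x s) /\ last (pos x) (walk c x s) = pos (last x s).
Proof.
elim: s x => //= y s IH x /andP[/cP[xy lxy _] /IH[ys lys]].
by rewrite /chain cat_path last_cat lxy; split=> //; apply/andP.
Qed.

(** A path without edges is excluded because [pos x] would then lie on no arc of
the path. *)
Lemma mem_walk x s z : path (@adj G) x s -> s != [::] -> z \in pos x :: walk c x s ->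
  exists u v, [/\ adj u v, [:: u; v] \subset x :: s & E u v z].
Proof.
elim: s x => //= y s IH x /andP[xy ys] _; rewrite inE mem_cat.
have sxy : [:: x; y] \subset x :: y :: s.
  by apply/fintype.subsetP => w; rewrite !inE orbA => ->.
case: (eqVneq z (pos x)) => [-> _|_ /=]; first by exists x, y; split=> //; exact: E_start.
case/orP=> [zxy|zs].
  by exists x, y; split=> //; case: (cP xy) => _ _; apply.
have s0 : s != [::] by move: zs; case: (s).
have [|u [v [uv suv Ez]]] := IH y ys s0; first by rewrite inE zs orbT.
exists u, v; split=> //; apply: (fintype.subset_trans suv).
by apply/fintype.subsetP => w wys; rewrite inE wys orbT.
Qed.
End Walk.

(** Replace each arc by a polyline whose steps are shorter than half the gap
between arcs of disjoint edges, and apply the parity argument to the polylines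
of the nine paths. Only paths without a common end need to be disjoint. *)
Theorem K33_subdivision_not_planar (a b : 'I_3 -> G) (P : 'I_3 -> 'I_3 -> seq G) :
    (forall i j, path (@adj G) (a i) (P i j)) ->
    (forall i j, last (a i) (P i j) = b j) ->
    (forall i i' j j', i != i' -> j != j' ->
      [disjoint a i :: P i j & a i' :: P i' j']%B) ->
  ~ planar R G.
Proof.
move=> pathP lastP disP [pos [E emb]].
have [e e0 gap] := embedding_gap emb.
have [_ _ arcE _ _] := emb.
pose d := e / 2.
have d0 : 0 < d by rewrite divr_gt0.
have /choice[c0 c0P] xy : exists s, adj xy.1 xy.2 ->
    [/\ chain d (pos xy.1) s, last (pos xy.1) s = pos xy.2 &
      {in s, forall z, E xy.1 xy.2 z}].
  case: xy => x y /=; have [xy|nxy] := boolP (adj x y); last by exists [::].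
  have A := arcE _ _ xy; have [Ex Ey] := arc_ends A.
  by have [s ?] := connected_chain (arc_connected A) Ex Ey d0; exists s.
pose c x y := c0 (x, y).
have cP x y : adj x y -> [/\ chain d (pos x) (c x y), last (pos x) (c x y) = pos y &
   {in c x y, forall z, E x y z}] by exact: (c0P (x, y)).
have E_start x y : adj x y -> E x y (pos x) by move=> xy; have [] := arc_ends (arcE _ _ xy).
have mem_b i j : b j \in a i :: P i j by rewrite -(lastP i j) mem_last.
have ne3 (i : 'I_3) : exists i' : 'I_3, i != i'.
  by exists (if i == ord0 then ord_max else ord0); case: (eqVneq i ord0) => [->//|].
(* If a path were empty, [a i] and [b j] would coincide, although they lie on two
   disjoint paths. *)
have P0 i j : P i j != [::].
  apply/eqP => Pij; have [i' ii] := ne3 i; have [j' jj] := ne3 j.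
  have ab : a i = b j by rewrite -(lastP i j) Pij.
  have ji : j' != j by rewrite eq_sym.
  have /disjointFr := disP _ _ _ _ ii ji => /(_ (a i) (mem_head _ _)).
  by rewrite ab mem_b.
apply: (@no_K33_chains R d (pos \o a) (pos \o b)
  (fun i j => walk c (a i) (P i j))) => //= [i j|i j|i i' j j' ii jj p q hp hq].
- by have [] := walk_chain cP (pathP i j).
- by have [_ ->] := walk_chain cP (pathP i j); rewrite lastP.
have [x [y [xy sxy Ep]]] := mem_walk cP E_start (pathP i j) (P0 i j) hp.
have [u [v [uv suv Eq]]] := mem_walk cP E_start (pathP i' j') (P0 i' j') hq.
have -> : d *+ 2 = e by rewrite /d -mulr_natr divfK.
apply: (gap x y u v) => //.
apply: disjointWl sxy _; apply: disjointWr suv _; exact: disP.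
Qed.
End K33Graph.

(** * Subdivisions inside grids *)

Section CodedSubgrid.
Variables (R : realType) (k : nat) (alpha : 'I_k -> nat) (axes : seq 'I_k).
Variable (bound : seq nat).
Hypothesis axes_uniq : uniq axes.
Hypothesis size_bound : size bound = size axes.
Hypothesis bound_alpha : forall i, i \in axes -> (nth 0%N bound (index i axes) <= alpha i)%N.

(** The list [s] gives the coordinates along [axes]; the other coordinates are 0,
since [index] is then out of the range of a list as long as [axes]. Small subgrids of an arbitrary
grid are thus handled by computation on lists of numbers. *)
Definition code_vertex (s : seq nat) : grid_graph alpha :=
  [ffun i => inord (nth 0%N s (index i axes)) : path_graph (alpha i)]%N.

Definition in_bound (s : seq nat) := all2 leq s bound.

Fixpoint code_adj (s t : seq nat) : bool :=
  match s, t with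
  | x :: s', y :: t' =>
    ((y == x.+1) || (x == y.+1)) && (s' == t') || (x == y) && code_adj s' t'
  | _, _ => false
  end.

Lemma in_boundP s : in_bound s ->
  size s = size axes /\ forall i, i \in axes -> (nth 0%N s (index i axes) <= alpha i)%N.
Proof.
rewrite /in_bound all2E size_bound => /andP[/eqP sz /allP le]; split=> // i ia.
apply: leq_trans (bound_alpha ia).
apply: (le (nth 0%N s (index i axes), nth 0%N bound (index i axes)))%N.
by rewrite -nth_zip ?size_bound // mem_nth // size_zip sz size_bound minnn index_mem.
Qed.

Lemma code_vertexE s i : in_bound s -> code_vertex s i = nth 0%N s (index i axes) :> nat.
Proof.
move=> /in_boundP[sz le]; rewrite /code_vertex ffunE inordK // ltnS.
have [/le//|nia] := boolP (i \in axes).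
by rewrite nth_default // sz memNindex.
Qed.

Lemma code_vertex_inj s t : in_bound s -> in_bound t ->
  code_vertex s = code_vertex t -> s = t.
Proof.
move=> sb tb st; have [sz _] := in_boundP sb; have [tz _] := in_boundP tb.
apply: (@eq_from_nth _ 0%N); first by rewrite sz tz.
rewrite sz => m lm.
case: axes axes_uniq (fun i => code_vertexE i sb) (fun i => code_vertexE i tb) lm => // i0 l.
set ax := i0 :: l => au sE tE lm.
by have := sE (nth i0 ax m); rewrite st tE index_uniq.
Qed.

Lemma code_adjP s t : code_adj s t -> exists2 m, (m < size s)%N &
  ((nth 0%N t m == (nth 0%N s m).+1) || (nth 0%N s m == (nth 0%N t m).+1))%N /\
  forall l, l != m -> nth 0%N s l = nth 0%N t l.
Proof.
elim: s t => [|x s IH] [|y t] //= /orP[/andP[xy /eqP <-]|/andP[/eqP <- /IH[m lm [h1 h2]]]].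
  by exists 0%N => //; split=> // -[].
by exists m.+1 => //; split=> // -[|l] //=; rewrite eqSS => /h2.
Qed.

Lemma code_vertex_adj s t : in_bound s -> in_bound t -> code_adj s t ->
  adj (code_vertex s) (code_vertex t).
Proof.
move=> sb tb /code_adjP[m lm [st eqs]]; have [sz _] := in_boundP sb.
have [i im] : exists i, index i axes = m.
  move: lm; rewrite sz; case: axes axes_uniq => // i0 l au lm.
  by exists (nth i0 (i0 :: l) m); rewrite index_uniq.
have ia : i \in axes by rewrite -index_mem im -sz.
apply/existsP; exists i; apply/andP; split.
  by rewrite /= /path_adj !code_vertexE // im.
apply/forallP => j; apply/implyP => ji; apply/eqP/val_inj.
rewrite /= !code_vertexE //; apply: eqs; apply: contra ji => /eqP jm.
by rewrite -(nth_index i ia) -[j](@nth_index _ i _ axes) ?im ?jm // -index_mem jm -sz.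
Qed.

Lemma coded_K33_not_planar (a b : 'I_3 -> seq nat) (P : 'I_3 -> 'I_3 -> seq (seq nat)) :
    (forall i j, path code_adj (a i) (P i j)) ->
    (forall i j, last (a i) (P i j) = b j) ->
    (forall i j, all in_bound (a i :: P i j)) ->
    (forall i i' j j', i != i' -> j != j' ->
      ~~ has [in a i :: P i j] (a i' :: P i' j')) ->
  ~ planar R (grid_graph alpha).
Proof.
move=> pathP lastP boundP disP.
apply: (@K33_subdivision_not_planar R _ (code_vertex \o a) (code_vertex \o b)
  (fun i j => map code_vertex (P i j))) => [i j|i j|i i' j j' ii jj] /=.
- elim: (P i j) (a i) (pathP i j) (boundP i j) => //= y s IH x.
  move=> /andP[xy ys] /and3P[bx b_y bs].
  by apply/andP; split; [exact: code_vertex_adj | apply: IH; rewrite //= b_y].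
- by rewrite last_map lastP.
rewrite -!map_cons disjoint_sym disjoint_has; apply/hasPn => _ /mapP[t tP' ->].
apply/negP => /mapP[s sP st].
have es : t = s.
  by apply: code_vertex_inj st; [exact: (allP (boundP i' j')) | exact: (allP (boundP i j))].
by have /hasPn/(_ t tP') := disP i i' j j' ii jj; rewrite es sP.
Qed.
End CodedSubgrid.

Lemma forall_ord3 (Q : 'I_3 -> Prop) :
  Q (@Ordinal 3 0 isT) -> Q (@Ordinal 3 1 isT) -> Q (@Ordinal 3 2 isT) -> forall i, Q i.
Proof.
by move=> q0 q1 q2 [[|[|[|//]]] h]; [move: q0 | move: q1 | move: q2];
  congr (Q _); apply: val_inj.
Qed.

(** A subdivision of the complete bipartite graph in the 4-dimensional cube: apexes
[dim4_a], feet [dim4_b], and paths [dim4_path i j] listed without their start. *)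
Definition dim4_a (i : 'I_3) : seq nat :=
  nth [::] [:: [:: 1; 0; 0; 1]; [:: 0; 0; 1; 0]; [:: 0; 0; 1; 1]]%N i.
Definition dim4_b (j : 'I_3) : seq nat :=
  nth [::] [:: [:: 0; 1; 1; 1]; [:: 0; 0; 0; 1]; [:: 1; 0; 1; 1]]%N j.
Definition dim4_path (i j : 'I_3) : seq (seq nat) := nth [::] (nth [::] [::
  [:: [:: [:: 1; 1; 0; 1]; [:: 0; 1; 0; 1]; [:: 0; 1; 1; 1]];
      [:: [:: 0; 0; 0; 1]];
      [:: [:: 1; 0; 1; 1]]];
  [:: [:: [:: 0; 1; 1; 0]; [:: 0; 1; 1; 1]];
      [:: [:: 0; 0; 0; 0]; [:: 0; 0; 0; 1]];
      [:: [:: 1; 0; 1; 0]; [:: 1; 0; 1; 1]]];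
  [:: [:: [:: 0; 1; 1; 1]];
      [:: [:: 0; 0; 0; 1]];
      [:: [:: 1; 0; 1; 1]]]] i) j.

(** The same kind of data in the grid with 3 x 3 x 2 vertices. *)
Definition dim3_a (i : 'I_3) : seq nat :=
  nth [::] [:: [:: 1; 0; 0]; [:: 1; 1; 1]; [:: 1; 2; 1]]%N i.
Definition dim3_b (j : 'I_3) : seq nat :=
  nth [::] [:: [:: 1; 1; 0]; [:: 2; 1; 1]; [:: 1; 0; 1]]%N j.
Definition dim3_path (i j : 'I_3) : seq (seq nat) := nth [::] (nth [::] [::
  [:: [:: [:: 1; 1; 0]];
      [:: [:: 2; 0; 0]; [:: 2; 0; 1]; [:: 2; 1; 1]];
      [:: [:: 1; 0; 1]]];
  [:: [:: [:: 1; 1; 0]];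
      [:: [:: 2; 1; 1]];
      [:: [:: 1; 0; 1]]];
  [:: [:: [:: 1; 2; 0]; [:: 1; 1; 0]];
      [:: [:: 2; 2; 1]; [:: 2; 1; 1]];
      [:: [:: 0; 2; 1]; [:: 0; 1; 1]; [:: 0; 0; 1]; [:: 1; 0; 1]]]] i) j.

Lemma grid_dim4_not_planar (R : realType) k (alpha : 'I_k -> nat) :
  (forall i, (0 < alpha i)%N) -> (3 < k)%N -> ~ planar R (grid_graph alpha).
Proof.
move=> alpha0 k4.
pose axes := map (widen_ord k4) (enum 'I_4).
have sz : size axes = 4 by rewrite size_map size_enum_ord.
apply: (@coded_K33_not_planar R k alpha axes [:: 1; 1; 1; 1]%N _ _ _ dim4_a dim4_b dim4_path).
- rewrite map_inj_uniq ?enum_uniq // => i j /(congr1 val) ij; exact: val_inj.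
- by rewrite sz.
- move=> i; rewrite -index_mem sz => il; apply: leq_trans (alpha0 i).
  by move: il; case: (index i axes) => [|[|[|[|]]]].
- by do 2!apply: forall_ord3.
- by do 2!apply: forall_ord3.
- by do 2!apply: forall_ord3.
- by do 4!apply: forall_ord3.
Qed.

Lemma grid_dim3_not_planar (R : realType) (alpha : 'I_3 -> nat) :
    (forall i, (0 < alpha i)%N) -> (1 < #|[set i | (1 < alpha i)%N]%SET|)%N ->
  ~ planar R (grid_graph alpha).
Proof.
move=> alpha0 /card_gt1P[i1 [i2 [h1 h2 i12]]]; rewrite !inE in h1 h2.
have [i3] : exists i3, i3 \in ~: [set i1; i2]%SET.
  apply/set0Pn; rewrite -card_gt0 cardsCs finset.setCK card_ord cards2.
  by case: (i1 != i2).
rewrite !inE negb_or => /andP[i31 i32].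
have au : uniq [:: i1; i2; i3] by rewrite /= !inE negb_or i12 ![_ == i3]eq_sym i31 i32.
apply: (@coded_K33_not_planar R 3 alpha [:: i1; i2; i3] [:: 2; 2; 1]%N _ _ _ dim3_a dim3_b dim3_path) => //.
- move=> i; rewrite !inE => /or3P[]/eqP->.
  + by rewrite /= eqxx.
  + by rewrite /= (negbTE i12) eqxx.
  + by rewrite /= ![_ == i3]eq_sym (negbTE i31) (negbTE i32) eqxx.
- by do 2!apply: forall_ord3.
- by do 2!apply: forall_ord3.
- by do 2!apply: forall_ord3.
- by do 4!apply: forall_ord3.
Qed.

(** * Straight-line drawings *)

Section StraightLine.
Variable R : realType.
Implicit Types p q : R * R.

Definition lerp p q (t : R) : R * R := p + t *: (q - p).

Lemma lerpE p q t :
  lerp p q t = (p.1 + t * (q.1 - p.1), p.2 + t * (q.2 - p.2)).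
Proof. by []. Qed.

Lemma lerp0 p q : lerp p q 0 = p. Proof. by rewrite /lerp scale0r addr0. Qed.

Lemma lerp1 p q : lerp p q 1 = q. Proof. by rewrite /lerp scale1r subrKC. Qed.

Lemma lerp_sym p q t : lerp p q t = lerp q p (1 - t).
Proof.
by rewrite /lerp scalerBl scale1r addrA subrKC -scalerN opprB.
Qed.

Lemma segment_arc p q : p != q -> is_arc p q (lerp p q @` `[0, 1]).
Proof.
move=> pq; exists (lerp p q); rewrite lerp0 lerp1; split=> //.
  apply: continuous_subspaceT => t; apply: cvgD; first exact: cvg_cst.
  by apply: cvgZr_tmp; exact: cvg_id.
move=> s t _ _ /addrI /eqP; rewrite -subr_eq0 -scalerBl scaler_eq0 !subr_eq0.
by rewrite [q == p]eq_sym (negbTE pq) orbF => /eqP.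
Qed.

(** It suffices that an interior point of an edge lies on no other edge: as every
vertex is the end of some edge, it then lies on no vertex either. *)
Lemma straight_planar (G : sgraph) (pos : G -> R * R) :
    (forall x, exists y : G, adj x y) ->
    (forall (x y u v : G) (s t : R), adj x y -> adj u v -> 0 < t < 1 -> 0 <= s <= 1 ->
       lerp (pos x) (pos y) t = lerp (pos u) (pos v) s ->
       [set x; y]%SET = [set u; v]%SET) ->
    injective pos ->
  planar R G.
Proof.
move=> nbr cross inj.
have inner x y z : adj x y ->
    ((lerp (pos x) (pos y) @` `[0, 1]) `\` [set pos x; pos y]) z ->
    exists2 t : R, 0 < t < 1 & z = lerp (pos x) (pos y) t.
  move=> xy [[t /=]]; rewrite in_itv /= => /andP[t0 t1] <- ends.
  exists t => //; rewrite !lt_neqAle t0 t1 !andbT; apply/andP; split.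
    by apply/eqP => t0'; apply: ends; left; rewrite -t0' lerp0.
  by apply/eqP => t1'; apply: ends; right; rewrite t1' lerp1.
exists pos, (fun x y => lerp (pos x) (pos y) @` `[0, 1]); split=> //.
- move=> x y _; apply/seteqP; split=> _ [t /= + <-]; rewrite in_itv /= => /andP[t0 t1];
    by exists (1 - t); rewrite /= ?in_itv /= -?lerp_sym // subr_ge0 t1 lerBlDr lerDl.
- move=> x y xy; apply: segment_arc; apply/eqP => /inj e.
  by move: xy; rewrite e adj_irr.
- move=> x y xy; apply/seteqP; split=> // z [/(inner _ _ _ xy)[t t01 ->] [w _ wz]].
  have [w' ww'] := nbr w.
  have : [set x; y]%SET = [set w; w']%SET.
    by apply: (cross x y w w' 0 t) => //; rewrite ?lerp0 ?lexx ?ler01.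
  move=> /setP/(_ w); rewrite !inE eqxx /= => /orP[]/eqP ew; subst w; move: wz.
    rewrite -{1}(lerp0 (pos x) (pos y)) => /addrI/eqP.
    rewrite -subr_eq0 -scalerBl scaler_eq0 !subr_eq0 => /orP[/eqP t0|/eqP/inj e].
      by rewrite -t0 ltxx in t01.
    by move: xy; rewrite e adj_irr.
  rewrite -{1}(lerp1 (pos x) (pos y)) => /addrI/eqP.
  rewrite -subr_eq0 -scalerBl scaler_eq0 !subr_eq0 => /orP[/eqP t0|/eqP/inj e].
    by rewrite -t0 ltxx andbF in t01.
  by move: xy; rewrite e adj_irr.
- move=> x y u v xy uv ne; apply/seteqP; split=> // z [/(inner _ _ _ xy)[t t01 ->] [s /= s01 zs]].
  by case/eqP: ne; apply: (cross _ _ _ _ s t); rewrite // -?zs // in_itv in s01.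
Qed.
Lemma mix_same (a t : R) : a + t * (a - a) = a.
Proof. by rewrite subrr mulr0 addr0. Qed.

Lemma mix_succ (m : nat) (t : R) : m%:R + t * (m.+1%:R - m%:R) = m%:R + t.
Proof. by rewrite -(natr1 m) [_ + 1]addrC addrK mulr1. Qed.

(** An interior point of a unit interval with integral ends determines the
interval, which is why an interior point of an edge determines the edge. *)
Lemma natr_frac_inj (m n : nat) (t s : R) : 0 < t < 1 -> 0 <= s <= 1 ->
  m%:R + t = n%:R + s -> m = n.
Proof.
move=> /andP[t0 t1] /andP[s0 s1] e; apply/eqP; rewrite eqn_leq.
by apply/andP; split; rewrite leqNgt; apply/negP; rewrite -(ler_nat R) -addn1 natrD; lra.
Qed.

Lemma natr_frac_neq (m n : nat) (t : R) : 0 < t < 1 -> m%:R + t <> n%:R.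
Proof.
move=> t01 e; have := @natr_frac_inj m n t 0 t01; rewrite lexx ler01 addr0.
by move=> /(_ isT e) mn; move: t01; rewrite mn in e; lra.
Qed.

End StraightLine.

Section GridDrawing.
Variables (R : realType) (k : nat) (alpha : 'I_k -> nat).
Implicit Types x y u v : grid_graph alpha.

Definition step (i : 'I_k) x y : Prop :=
  (y i = (x i).+1 :> nat) /\ forall j, j != i -> x j = y j.

Lemma grid_adj_step x y : adj x y -> exists i, step i x y \/ step i y x.
Proof.
move=> /existsP[i /andP[/orP[]/eqP xy /forallP eqs]]; exists i; [left|right];
  split=> // j ji; have /implyP/(_ ji)/eqP := eqs j => //.
Qed.

Lemma grid_neighbour : (0 < k)%N -> (forall i, (0 < alpha i)%N) ->
  forall x, exists y, adj x y.
Proof.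
move=> k0 alpha0 x; pose i : 'I_k := Ordinal k0.
pose n := if (x i == 0%N :> nat) then 1%N else (x i).-1.
have na : (n < (alpha i).+1)%N.
  by rewrite /n; case: eqP => _; [rewrite ltnS | apply: leq_ltn_trans (leq_pred _) _].
exists [ffun j => inord (if j == i then n else x j) : path_graph (alpha j)].
apply/existsP; exists i; apply/andP; split.
  rewrite /= /path_adj ffunE eqxx inordK // /n.
  by case: (nat_of_ord (x i)) => //= m; rewrite eqxx orbT.
by apply/forallP => j; apply/implyP => ji; rewrite ffunE (negbTE ji) inord_val.
Qed.

(** The parametrization of a segment can be reversed, so only the edges oriented
along increasing coordinates need to be compared. *)
Lemma grid_straight_planar (pos : grid_graph alpha -> R * R) :
    (0 < k)%N -> (forall i, (0 < alpha i)%N) ->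
    (forall i j x y u v (s t : R), step i x y -> step j u v ->
      0 < t < 1 -> 0 <= s <= 1 ->
      lerp (pos x) (pos y) t = lerp (pos u) (pos v) s -> i = j /\ x = u) ->
    injective pos ->
  planar R (grid_graph alpha).
Proof.
move=> k0 alpha0 cross; apply: straight_planar; first exact: grid_neighbour.
have cross_set i j x y u v (s t : R) : step i x y -> step j u v ->
      0 < t < 1 -> 0 <= s <= 1 ->
      lerp (pos x) (pos y) t = lerp (pos u) (pos v) s -> [set x; y]%SET = [set u; v]%SET.
  move=> xy uv t01 s01 e; have [ij xu] := cross _ _ _ _ _ _ _ _ xy uv t01 s01 e.
  subst j u; suff -> : y = v by [].
  apply/ffunP => j; have [->|ji] := eqVneq j i.
    by apply: ord_inj; case: xy => -> _; case: uv => -> _.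
  by case: xy => _ <- //; case: uv => _ <-.
move=> x y u v s t /grid_adj_step[i xy] /grid_adj_step[j uv] t01 s01.
have t01' : 0 < 1 - t < 1 by move: t01 => /andP[? ?]; apply/andP; split; lra.
have s01' : 0 <= 1 - s <= 1 by move: s01 => /andP[? ?]; apply/andP; split; lra.
case: xy uv => xy [] uv.
- exact: cross_set xy uv t01 s01.
- rewrite (lerp_sym (pos u)) (finset.setUC [set u]%SET).
  exact: cross_set xy uv t01 s01'.
- rewrite (lerp_sym (pos x)) (finset.setUC [set x]%SET).
  exact: cross_set xy uv t01' s01.
- rewrite (lerp_sym (pos x)) (lerp_sym (pos u)).
  rewrite (finset.setUC [set x]%SET) (finset.setUC [set u]%SET).
  exact: cross_set xy uv t01' s01'.
Qed.

End GridDrawing.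

(** * Grids of dimension at most two *)

Section TwoDimensional.
Variables (R : realType) (k : nat) (alpha : 'I_k -> nat).
Implicit Types x y u v : grid_graph alpha.

(** The default value 0 lets the one-dimensional grid be drawn on the horizontal
axis, as a special case of the two-dimensional one. *)
Definition coord x (m : nat) : nat := if insub m is Some i then x i else 0%N.

Lemma coordE x (i : 'I_k) : coord x i = x i.
Proof. by rewrite /coord valK. Qed.

Lemma coord_step i x y : step i x y -> coord y i = (coord x i).+1 /\
  forall m : nat, m != i -> coord y m = coord x m.
Proof.
move=> [xy eqs]; rewrite !coordE; split=> // m mi; rewrite /coord.
by case: insubP => // j _ jm; rewrite eqs // -val_eqE jm.
Qed.

Lemma coord_inj x u : (forall m, (m < k)%N -> coord x m = coord u m) -> x = u.
Proof.
by move=> xu; apply/ffunP => i; apply: ord_inj; rewrite -!coordE xu.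
Qed.

Lemma grid_dim2_planar : (0 < k <= 2)%N -> (forall i, (0 < alpha i)%N) ->
  planar R (grid_graph alpha).
Proof.
move=> /andP[k0 k2] alpha0.
have lt2 (m : nat) : (m < k)%N -> m = 0%N \/ m = 1%N.
  by case: m => [|[|m]] mk; [left | right | have := leq_trans mk k2].
have ext x u : coord x 0 = coord u 0 -> coord x 1 = coord u 1 -> x = u.
  by move=> e0 e1; apply: coord_inj => m /lt2[] ->.
apply: (@grid_straight_planar _ _ _ (fun x => ((coord x 0)%:R, (coord x 1)%:R))) => //.
  move=> i j x y u v s t /coord_step[xi xe] /coord_step[ui ue] t01 s01.
  rewrite !lerpE /=.
  have [i0|i1] := lt2 i (ltn_ord i); have [j0|j1] := lt2 j (ltn_ord j).
  - rewrite i0 in xi xe; rewrite j0 in ui ue.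
    rewrite xi ui (xe 1%N) // (ue 1%N) // !mix_same !mix_succ => -[e /eqP].
    rewrite eqr_nat => /eqP e1; have e0 := natr_frac_inj t01 s01 e.
    by split; [apply: ord_inj; rewrite i0 j0 | exact: ext].
  - rewrite i0 in xi xe; rewrite j1 in ui ue.
    rewrite xi ui (xe 1%N) // (ue 0%N) // !mix_same !mix_succ => -[e _].
    by case: (natr_frac_neq t01 e).
  - rewrite i1 in xi xe; rewrite j0 in ui ue.
    rewrite xi ui (xe 0%N) // (ue 1%N) // !mix_same !mix_succ => -[_ e].
    by case: (natr_frac_neq t01 e).
  - rewrite i1 in xi xe; rewrite j1 in ui ue.
    rewrite xi ui (xe 0%N) // (ue 0%N) // !mix_same !mix_succ => -[/eqP].
    rewrite eqr_nat => /eqP e0 e; have e1 := natr_frac_inj t01 s01 e.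
    by split; [apply: ord_inj; rewrite i1 j1 | exact: ext].
by move=> x u [/eqP + /eqP]; rewrite !eqr_nat => /eqP e0 /eqP e1; exact: ext.
Qed.
End TwoDimensional.

(** * Three-dimensional grids with two short sides *)

Section ConcentricSquares.
Variables (R : realType) (alpha : 'I_3 -> nat) (i0 i1 i2 : 'I_3).
Hypothesis i012 : uniq [:: i0; i1; i2].
Hypotheses (alpha_i1 : alpha i1 = 1%N) (alpha_i2 : alpha i2 = 1%N).
Hypothesis (alpha_gt0 : forall i, (0 < alpha i)%N).
Implicit Types x y u v : grid_graph alpha.

Definition radius x : R := (x i0)%:R + 1.

Definition sign (n : nat) : R := n%:R *+ 2 - 1.

(** The layer [x i0 = n] is a 4-cycle; it is drawn as the boundary of the square
with corners (+-(n+1), +-(n+1)), and the edges along [i0] join corresponding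
corners of consecutive squares. *)
Definition square_corner x : R * R :=
  (sign (x i1) * radius x, sign (x i2) * radius x).

Lemma axis_cases (i : 'I_3) : [\/ i = i0, i = i1 | i = i2].
Proof.
have : i \in [:: i0; i1; i2].
  suff -> : [:: i0; i1; i2] =i enum 'I_3 by rewrite mem_enum.
  have [] // := @uniq_min_size _ [:: i0; i1; i2] (enum 'I_3) i012.
    by move=> l _; rewrite mem_enum.
  by rewrite size_enum_ord.
by rewrite !inE => /or3P[]/eqP; [constructor 1 | constructor 2 | constructor 3].
Qed.

Lemma short_le1 x i : alpha i = 1%N -> (x i <= 1)%N.
Proof.
by move=> ai; apply: (@leq_trans (alpha i)); [rewrite -ltnS; exact: ltn_ord | rewrite ai].
Qed.

Lemma sign_cases x i : alpha i = 1%N -> sign (x i) = -1 \/ sign (x i) = 1.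
Proof.
move=> ai; have := short_le1 x ai; rewrite /sign.
case: (nat_of_ord (x i)) => [|[|//]] _; [left|right].
  by rewrite mul0rn add0r.
by rewrite mulr2n addrK.
Qed.

Lemma sign_inj : injective sign.
Proof.
move=> m n; rewrite /sign => /addIr /eqP; rewrite !mulr2n -!natrD eqr_nat !addnn.
by move=> /eqP/double_inj.
Qed.

Lemma signed_eq (e e' A B : R) : (e = -1 \/ e = 1) -> (e' = -1 \/ e' = 1) ->
  0 < A -> 0 < B -> e * A = e' * B -> e = e' /\ A = B.
Proof. by move=> [] -> [] -> A0 B0 AB; split; lra. Qed.

Lemma radius_ge1 x : 1 <= radius x.
Proof. by rewrite /radius lerDr ler0n. Qed.

Lemma vertex_ext x u : radius x = radius u -> sign (x i1) = sign (u i1) ->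
  sign (x i2) = sign (u i2) -> x = u.
Proof.
move=> /addIr/eqP; rewrite eqr_nat => /eqP e0 /sign_inj e1 /sign_inj e2.
by apply/ffunP => i; apply: ord_inj; case: (axis_cases i) => ->.
Qed.

Lemma edge_point0 x y t : step i0 x y -> lerp (square_corner x) (square_corner y) t =
  (sign (x i1) * (radius x + t), sign (x i2) * (radius x + t)).
Proof.
move=> [xy eqs]; move: i012; rewrite /= !inE negb_or => /and3P[/andP[n01 n02] _ _].
rewrite lerpE /square_corner /radius /= xy -!eqs 1?eq_sym // -natr1.
by congr (_, _); ring.
Qed.

Lemma edge_point1 x y t : step i1 x y -> lerp (square_corner x) (square_corner y) t =
  (radius x * (2 * t - 1), sign (x i2) * radius x).
Proof.
move=> [xy eqs]; move: i012; rewrite /= !inE negb_or => /and3P[/andP[n01 n02] n12 _].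
have := short_le1 y alpha_i1; rewrite xy ltnS leqn0 => /eqP x0.
rewrite lerpE /square_corner /radius /= xy -(eqs i0) // -(eqs i2) 1?eq_sym // x0 /sign.
by congr (_, _); ring.
Qed.

Lemma edge_point2 x y t : step i2 x y -> lerp (square_corner x) (square_corner y) t =
  (sign (x i1) * radius x, radius x * (2 * t - 1)).
Proof.
move=> [xy eqs]; move: i012; rewrite /= !inE negb_or => /and3P[/andP[n01 n02] n12 _].
have := short_le1 y alpha_i2; rewrite xy ltnS leqn0 => /eqP x0.
rewrite lerpE /square_corner /radius /= xy -!eqs // x0 /sign.
by congr (_, _); ring.
Qed.

Lemma step_sign i x y : alpha i = 1%N -> step i x y -> sign (x i) = -1.
Proof.
move=> ai [xy _]; have := short_le1 y ai; rewrite xy ltnS leqn0.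
by move=> /eqP->; rewrite /sign mul0rn add0r.
Qed.

(** The greatest absolute value of the two coordinates is [radius x] on an edge of
a square and [radius x + t] on a diagonal one, which separates the squares from
the interiors of the diagonal edges. On each edge of a square, one coordinate is
less than the radius in absolute value except at the ends. *)
Lemma squares_cross i j x y u v (s t : R) : step i x y -> step j u v ->
    0 < t < 1 -> 0 <= s <= 1 ->
    lerp (square_corner x) (square_corner y) t =
    lerp (square_corner u) (square_corner v) s -> i = j /\ x = u.
Proof.
move=> xy uv t01 s01.
have [x1 x2] := (sign_cases x alpha_i1, sign_cases x alpha_i2).
have [u1 u2] := (sign_cases u alpha_i1, sign_cases u alpha_i2).
have [rx ru] := (radius_ge1 x, radius_ge1 u).
have [t0 t1] := andP t01; have [s0 s1] := andP s01.
have rt0 : 0 < radius x * t by rewrite mulr_gt0 //; lra.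
have rt1 : 0 < radius x * (1 - t) by rewrite mulr_gt0 //; lra.
have rs0 : 0 <= radius u * s by rewrite mulr_ge0 //; lra.
have rs1 : 0 <= radius u * (1 - s) by rewrite mulr_ge0 //; lra.
have frac_inj : radius x + t = radius u + s -> radius x = radius u.
  by move=> e; rewrite /radius; congr (_%:R + 1); apply: (natr_frac_inj t01 s01);
    move: e; rewrite /radius; lra.
have frac_neq : radius x + t <> radius u.
  move=> e; apply: (@natr_frac_neq R (x i0) (u i0) t t01).
  by move: e; rewrite /radius; lra.
have [rt_gt0 rs_gt0] : 0 < radius x + t /\ 0 < radius u + s by split; lra.
have [rx0 ru0] : 0 < radius x /\ 0 < radius u by split; lra.
case: (axis_cases i) => ii; case: (axis_cases j) => jj; subst i j;
  rewrite ?(edge_point0 _ xy) ?(edge_point1 _ xy) ?(edge_point2 _ xy)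
    ?(edge_point0 _ uv) ?(edge_point1 _ uv) ?(edge_point2 _ uv) => -[e1 e2].
- have [f1 f] := signed_eq x1 u1 rt_gt0 rs_gt0 e1.
  have [f2 _] := signed_eq x2 u2 rt_gt0 rs_gt0 e2.
  by split=> //; exact: vertex_ext (frac_inj f) f1 f2.
- by have [_ /frac_neq] := signed_eq x2 u2 rt_gt0 ru0 e2.
- by have [_ /frac_neq] := signed_eq x1 u1 rt_gt0 ru0 e1.
- have [_ f] := signed_eq x2 u2 rx0 rs_gt0 e2.
  by exfalso; move: e1; rewrite -f; case: u1 => ->; lra.
- have [f2 f] := signed_eq x2 u2 rx0 ru0 e2.
  split=> //; apply: vertex_ext f _ f2.
  by rewrite (step_sign alpha_i1 xy) (step_sign alpha_i1 uv).
- by exfalso; move: e1 e2; case: u1 => ->; case: x2 => ->; lra.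
- have [_ f] := signed_eq x1 u1 rx0 rs_gt0 e1.
  by exfalso; move: e2; rewrite -f; case: u2 => ->; lra.
- by exfalso; move: e1 e2; case: x1 => ->; case: u2 => ->; lra.
- have [f1 f] := signed_eq x1 u1 rx0 ru0 e1.
  split=> //; apply: vertex_ext f f1 _.
  by rewrite (step_sign alpha_i2 xy) (step_sign alpha_i2 uv).
Qed.

Lemma square_corner_inj : injective square_corner.
Proof.
move=> x u [e1 e2].
have [rx ru] : 0 < radius x /\ 0 < radius u.
  by have [? ?] := (radius_ge1 x, radius_ge1 u); split; lra.
have [f1 f] := signed_eq (sign_cases x alpha_i1) (sign_cases u alpha_i1) rx ru e1.
have [f2 _] := signed_eq (sign_cases x alpha_i2) (sign_cases u alpha_i2) rx ru e2.
exact: vertex_ext.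
Qed.

Lemma concentric_squares_planar : planar R (grid_graph alpha).
Proof. exact: (@grid_straight_planar R 3 alpha _ isT alpha_gt0 squares_cross square_corner_inj). Qed.
End ConcentricSquares.


Lemma grid_dim3_planar (R : realType) (alpha : 'I_3 -> nat) :
    (forall i, (0 < alpha i)%N) -> (#|[set i | (1 < alpha i)%N]%SET| <= 1)%N ->
  planar R (grid_graph alpha).
Proof.
move=> alpha0 long1; set L := [set i | _]%SET in long1.
have [i0 i0L] : exists i0, L \subset [set i0]%SET.
  have [->|[i iL]] := set_0Vmem L; first by exists ord0; rewrite finset.sub0set.
  exists i; apply/fintype.subsetP => j jL; rewrite inE eq_sym.
  by apply/eqP; exact: (card_le1_eqP long1).
(* [i0] is the only direction that may be long; [i1] and [i2] are the other two. *)
have [i1 [i2 i12]] : exists i1 i2, uniq [:: i0; i1; i2].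
  case: i0 {i0L} => [[|[|[|//]]] h]; first by exists (inord 1), (inord 2);
    rewrite /= !inE -!val_eqE /= !inordK.
    by exists (inord 0), (inord 2); rewrite /= !inE -!val_eqE /= !inordK.
  by exists (inord 0), (inord 1); rewrite /= !inE -!val_eqE /= !inordK.
have short i : i != i0 -> alpha i = 1%N.
  move=> ne; apply/eqP; rewrite eqn_leq alpha0 andbT leqNgt; apply: contra ne => ai.
  by have /fintype.subsetP/(_ i) := i0L; rewrite !inE; apply.
apply: (@concentric_squares_planar R alpha i0 i1 i2) => //; apply: short;
  by move: i12; rewrite /= !inE negb_or ![i0 == _]eq_sym => /and3P[/andP[? ?] _ _].
Qed.

Theorem proposition4 (R : realType) (k : nat) (alpha : 'I_k -> nat)
    (hk : (1 <= k)%N) (halpha : forall i, (0 < alpha i)%N) :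
  planar R (grid_graph alpha) <->
  (k <= 2)%N \/
  (k = 3%N /\ (#|[set i : 'I_k | (1 < alpha i)%N]%SET| <= 1)%N).
Proof.
split=> [pl|[k2|[k3 long1]]].
- have [k2|k3] := leqP k 2; [by left | right].
  have [k4|k3'] := ltnP 3 k; first by case: (grid_dim4_not_planar halpha k4 pl).
  have ek : k = 3 by apply/eqP; rewrite eqn_leq k3' k3.
  subst k; split=> //; rewrite leqNgt; apply/negP => long.
  exact: grid_dim3_not_planar halpha long pl.
- by apply: grid_dim2_planar => //; rewrite hk.
- by subst k; exact: grid_dim3_planar.
Qed.
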